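(* Let $q$ be an odd prime power, $m\geq 2$ and $n=\frac{q^m+1}{2}$. Then the negacyclic BCH code $\mathcal{C}_{(q,n,2,0)}$, whose generator polynomial is $\mathbb{M}_{\beta}(x)$, has parameters $[n,n-2m,d]$, where $d=5$ if $q=3$; $d=3$ if $m$ is odd and $q>3$; and $d=4$ if $m$ is even and $q>3$.
   Context: Let $\ell$ be the order of $q$ modulo $2n$, $\alpha$ a primitive element of $\mathrm{GF}(q^\ell)$, $\beta=\alpha^{(q^\ell-1)/(2n)}$ (a primitive $2n$-th root of unity), and $\mathbb{M}_{\beta}(x)$ the minimal polynomial of $\beta$ over $\mathrm{GF}(q)$. $\mathcal{C}_{(q,n,2,0)}$ is the negacyclic code of length $n$ over $\mathrm{GF}(q)$, i.e. the ideal of $\mathrm{GF}(q)[x]/(x^n+1)$ generated by $\mathbb{M}_{\beta}(x)$. Parameters $[n,k,d]$ are length, dimension, minimum Hamming distance. *)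

(* Defs.v *)
From HB Require Import structures.
From mathcomp Require Import all_boot all_order all_algebra all_field.
Set Implicit Arguments. Unset Strict Implicit. Unset Printing Implicit Defensive.
Import GRing.Theory.
Local Open Scope ring_scope.

Definition is_order_mod (l a N : nat) : Prop :=
  (0 < l)%N /\ a ^ l = 1 %[mod N] /\
  (forall k, (0 < k < l)%N -> a ^ k <> 1 %[mod N]).

Definition is_min_poly (F : fieldType) (L : fieldExtType F)
    (g : {poly F}) (x : L) : Prop :=
  g \is monic /\ root (map_poly (in_alg L) g) x /\
  (forall p : {poly F}, root (map_poly (in_alg L) p) x -> g %| p).

Definition poly_of_word (F : fieldType) (n : nat) (c : 'rV[F]_n) : {poly F} :=
  \sum_(i < n) c 0 i *: 'X^i.

(* c belongs to the negacyclic code of length n generated by g, i.e. the ideal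
   of F[x]/(x^n+1) generated by g (elements represented as remainders mod x^n+1). *)
Definition in_negacyclic_code (F : fieldType) (n : nat) (g : {poly F})
    (c : 'rV[F]_n) : Prop :=
  exists a : {poly F}, poly_of_word c = (a * g) %% ('X^n + 1).

Definition hweight (F : fieldType) (n : nat) (c : 'rV[F]_n) : nat :=
  #|[set i : 'I_n | c 0 i != 0]|.

Definition negacyclic_params (F : fieldType) (n : nat) (g : {poly F})
    (k d : nat) : Prop :=
  (exists C : {vspace 'rV[F]_n},
      (forall c, c \in C <-> in_negacyclic_code g c) /\ \dim C = k) /\
  (exists c : 'rV[F]_n, in_negacyclic_code g c /\ c != 0 /\ hweight c = d) /\
  (forall c : 'rV[F]_n, in_negacyclic_code g c -> c != 0 -> (d <= hweight c)%N).

(* Main.v *)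
Require Import Defs.
From HB Require Import structures.
From mathcomp Require Import all_boot all_order all_algebra all_field.
From mathcomp Require Import pgroup abelian zify ring.

(* The code is the kernel of the syndrome map c |-> sum_i c_i beta^i.  As beta
   has order 2n = q^m + 1, its conjugates include beta and beta^-1, and beta^3
   and beta^-3 too when q = 3, so the BCH bound gives d >= 3, and d >= 5 when
   q = 3.  The upper bounds d <= 5 (q = 3) and d <= 4 (q > 3) come from the
   pigeonhole principle: there are too many words of weight 2 (for q = 3, with
   one further free coordinate) for all of their syndromes to differ; when
   q = 3 and n = 5 the upper bound is n itself.
   For m odd, gamma = beta^(2n/(q+1)) has order q + 1, so its trace
   t = gamma + gamma^-1 lies in F and 1 - t X^s + X^(2s), s = 2n/(q+1), is a
   codeword; 2s < n because q > 3.  For m even, a relation a x + b y + c z = 0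
   between (q^m+1)-st roots of unity can be multiplied by its image under
   Frobenius^m, which inverts x, y and z; this puts x/y + y/x in F, hence x/y in
   GF(q^2), a subfield of GF(q^m), and then x/y = +-1. *)

Set Implicit Arguments. Unset Strict Implicit. Unset Printing Implicit Defensive.
Import GRing.Theory.
Local Open Scope ring_scope.

(** * Syndromes and the BCH bound *)

Section Syndrome.
Variables (F : fieldType) (L : fieldExtType F) (n : nat).
Implicit Types (x y z : L) (c : 'rV[F]_n).

Definition wsupp c : {set 'I_n} := [set i | c 0 i != 0].

Definition syndrome x c : L := \sum_(i < n) c 0 i *: x ^+ i.

Lemma syndrome_is_linear x : linear (syndrome x).
Proof.
move=> a u v; rewrite /syndrome scaler_sumr -big_split /=.
by apply: eq_bigr => i _; rewrite !mxE scalerDl scalerA.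
Qed.

HB.instance Definition _ x :=
  GRing.isLinear.Build F 'rV[F]_n L _ (syndrome x) (syndrome_is_linear x).

Lemma horner_poly_of_word x c :
  (map_poly (in_alg L) (poly_of_word c)).[x] = syndrome x c.
Proof.
rewrite /poly_of_word /syndrome rmorph_sum /= horner_sum; apply: eq_bigr => i _.
by rewrite linearZ /= map_polyXn hornerZ hornerXn mulr_algl.
Qed.

Lemma size_poly_of_word c : (size (poly_of_word c) <= n)%N.
Proof.
apply: (leq_trans (size_sum _ _ _)); apply/bigmax_leqP => i _.
by apply: (leq_trans (size_scale_leq _ _)); rewrite size_polyXn.
Qed.

(** As [x] is a root of [X^n + 1], [g] divides that modulus, so reduction preserves divisibility by
    [g]; a word polynomial has degree below [n] and is its own remainder. *)
Lemma in_negacyclic_codeP x g c : (0 < n)%N -> is_min_poly g x -> x ^+ n = -1 ->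
  in_negacyclic_code g c <-> syndrome x c = 0.
Proof.
move=> n_gt0 [_ [gx gmin]] xn; rewrite -horner_poly_of_word.
have g_dvd : g %| 'X^n + 1.
  apply: gmin; rewrite rootE rmorphD /= map_polyXn rmorph1 !hornerE xn.
  by rewrite addNr.
split=> [[a ca]|cx].
  have : g %| poly_of_word c by rewrite ca -dvdp_mod // dvdp_mull.
  case/dvdpP=> b ->; rewrite rmorphM hornerM /= (rootP gx) mulr0 //.
have /dvdpP[a ca] : g %| poly_of_word c by apply/gmin/rootP.
exists a; rewrite -ca modp_small // size_XnaddC //.
by rewrite ltnS size_poly_of_word.
Qed.

(** Replaces the Vandermonde determinant: if the weight were at most [d], the coefficients of a
    polynomial vanishing at [z^j] for every support index [j] except [i0] would combine the [d] zero
    syndromes into a single nonzero term. *)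
Lemma bch_bound d y z c : n.-primitive_root z -> y != 0 -> c != 0 ->
  (forall k, (k < d)%N -> syndrome (y * z ^+ k) c = 0) -> (d < hweight c)%N.
Proof.
move=> zP y0 c0 synd0; rewrite ltnNge; apply/negP => le_d.
have [i0 ci0] : exists i, c 0 i != 0.
  apply/existsP; apply: contraNT c0 => /existsPn c0.
  by apply/eqP/rowP => i; rewrite mxE; apply/eqP; have := c0 i; rewrite negbK.
pose p := \prod_(j in wsupp c :\ i0) ('X - (z ^+ j)%:P).
have sp : (size p <= d)%N.
  rewrite /p -big_enum /= size_prod_XsubC -cardE.
  by move: le_d; rewrite /hweight (cardsD1 i0) inE ci0.
have S0 : \sum_(i < n) c 0 i *: y ^+ i * p.[z ^+ i] = 0.
  under eq_bigr => i _.
    rewrite (horner_coef_wide _ sp) mulr_sumr. over.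
  rewrite exchange_big big1 //= => k _.
  transitivity (p`_k * syndrome (y * z ^+ k) c); last by rewrite synd0 ?mulr0.
  rewrite /syndrome mulr_sumr; apply: eq_bigr => i _.
  by rewrite exprMn -!exprM mulnC -scalerAl -scalerAr mulrCA.
move: S0; rewrite (bigD1 i0) //= big1 ?addr0 => [|i ii0].
  move/eqP; rewrite mulf_eq0 scaler_eq0 (negPf ci0) expf_eq0 (negPf y0) andbF /=.
  rewrite horner_prod prodf_seq_eq0 => /hasP[j _] /andP[].
  rewrite !inE => /andP[ji0 _]; rewrite !hornerE subr_eq0 (eq_prim_root_expr zP).
  by rewrite !modn_small // => /eqP/ord_inj ij; rewrite ij eqxx in ji0.
have [->|ci] := eqVneq (c 0 i) 0; first by rewrite scale0r mul0r.
rewrite horner_prod (bigD1 i) /=; last by rewrite !inE ii0.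
by rewrite hornerXsubC subrr mul0r mulr0.
Qed.

End Syndrome.

(** * Frobenius powers, dimension of the code, and counting of words *)

Section Finite.
Variables (F : finFieldType) (L : fieldExtType F).
Local Notation q := #|F|.

(** The additive group of [F] is an elementary abelian p-group. This is what makes q-th powers
    additive on [L]. *)
Lemma pchar_nat_card : [pchar L].-nat q.
Proof.
have [p p_pr pF] := finPcharP F.
have /abelem_pgroup : (p.-abelem [set: F])%g by apply: fin_ring_pchar_abelem.
rewrite /pgroup cardsT; apply: sub_in_pnat => r _ /eqP ->.
by rewrite pchar_lalg.
Qed.

Lemma exprqD (x y : L) k : (x + y) ^+ (q ^ k) = x ^+ (q ^ k) + y ^+ (q ^ k).
Proof. by rewrite exprDn_pchar // pnatX pchar_nat_card. Qed.

Lemma exprq_scale (a : F) (x : L) k : (a *: x) ^+ (q ^ k) = a *: x ^+ (q ^ k).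
Proof.
elim: k x => // k IH x; rewrite expnSr !exprM IH -mulr_algl exprMn.
by rewrite -in_algE -rmorphXn /= expf_card mulr_algl.
Qed.

(** [X^q - X] is the product of all [X - a] with [a] in [F], so it has no other roots in [L]. *)
Lemma exprq_fixed (x : L) : x ^+ q = x -> exists a : F, x = a%:A.
Proof.
move=> xq; have /(congr1 (fun p => (map_poly (in_alg L) p).[x])) := finField_genPoly F.
rewrite rmorphB /= map_polyXn map_polyX !hornerE xq subrr.
rewrite rmorph_prod horner_prod => /esym/eqP; rewrite prodf_seq_eq0 => /hasP[a _].
rewrite /= rmorphB /= map_polyX map_polyC !hornerE subr_eq0 => /eqP ->.
by exists a.
Qed.

Lemma expr0q k : 0 ^+ (q ^ k) = 0 :> L.
Proof. by rewrite expr0n expn_eq0 -leqn0 leqNgt (ltnW (finNzRing_gt1 F)). Qed.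

(** Frobenius fixes the coefficients of [c]; hence a word vanishing at [x] vanishes at all
    conjugates of [x]. *)
Lemma syndromeXq n (x : L) k (c : 'rV[F]_n) :
  syndrome (x ^+ (q ^ k)) c = syndrome x c ^+ (q ^ k).
Proof.
rewrite /syndrome (big_morph _ (fun u v => exprqD u v k) (expr0q k)).
by apply: eq_bigr => i _; rewrite exprq_scale exprAC.
Qed.

Lemma syndrome_delta n (x : L) (i : 'I_n) :
  syndrome x (delta_mx 0 i : 'rV[F]_n) = x ^+ i.
Proof.
rewrite /syndrome (bigD1 i) //= big1 => [|j ji]; rewrite !mxE ?eqxx ?scale1r ?addr0 //.
by rewrite (negPf ji) scale0r.
Qed.

(** By rank-nullity it suffices that the syndrome map is onto [L]. Already on words of length [r] it
    is injective, hence onto by dimension. *)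
Lemma dim_syndrome_ker n (x : L) : (\dim {:L} <= n)%N ->
  {in gtn (\dim {:L}) &, injective (fun i => x ^+ (q ^ i))} ->
  \dim (lker (linfun (@syndrome F L n x))) = (n - \dim {:L})%N.
Proof.
set r := \dim {:L} => le_rn inj_conj.
(* a polynomial of degree < r vanishing at x has r distinct conjugate roots *)
have ker0 : lker (linfun (@syndrome F L r x)) = 0%VS.
  apply/eqP; rewrite -subv0; apply/subvP => c.
  rewrite memv_ker lfunE /= memv0 => /eqP c0.
  pose p := map_poly (in_alg L) (poly_of_word c).
  have p0 : p = 0.
    apply: contraTeq (size_poly_of_word c) => p_neq0; rewrite -ltnNge.
    rewrite -(size_map_poly (in_alg L)).
    rewrite -[X in (X < _)%N](size_iota 0) -(size_map (fun i => x ^+ (q ^ i))).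
    apply: max_poly_roots => //.
      apply/allP => _ /mapP[i _ ->].
      by rewrite rootE horner_poly_of_word syndromeXq c0 expr0q.
    rewrite map_inj_in_uniq ?iota_uniq // => i j.
    by rewrite !mem_iota => /andP[_ +] /andP[_ +]; apply: inj_conj.
  apply/eqP/rowP => i; rewrite mxE.
  have /(congr1 (fun p : {poly F} => p`_i)) : poly_of_word c = 0.
    by apply/eqP; rewrite -(map_poly_eq0 (in_alg L)) -/p p0.
  rewrite coef0 /poly_of_word coef_sum (bigD1 i) //= big1 => [|j ji].
    by rewrite coefZ coefXn eqxx mulr1 addr0.
  by rewrite coefZ coefXn eq_sym (inj_eq val_inj) (negPf ji) mulr0.
have dim_img : \dim (limg (linfun (@syndrome F L r x))) = r.
  have := limg_ker_dim (linfun (@syndrome F L r x)) fullv.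
  by rewrite ker0 capv0 dimv0 add0n => ->; rewrite dimvf; exact: mul1n.
have full : (fullv <= limg (linfun (@syndrome F L n x)))%VS.
  apply: (@subv_trans _ _ (limg (linfun (@syndrome F L r x)))).
    by rewrite -(geq_leqif (dimv_leqif_sup (subvf _))) dim_img.
  apply/subvP => _ /memv_imgP[c _ ->]; rewrite lfunE /= memv_suml // => i _.
  rewrite memvZ // -[_ ^+ _](syndrome_delta x (widen_ord le_rn i)) -lfunE.
  by rewrite memv_img ?memvf.
have := limg_ker_dim (linfun (@syndrome F L n x)) fullv.
have -> : limg (linfun (@syndrome F L n x)) = fullv.
  by apply/eqP; rewrite eqEsubv subvf.
rewrite capfv -/r [X in _ = X -> _]dimvf => e.
have {}e : (\dim (lker (linfun (@syndrome F L n x))) + r = n)%N.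
  by rewrite e; exact: mul1n.
by rewrite -[in RHS]e addnK.
Qed.

(** Sort the words by [D], their support outside [E]: entries are free on [E], nonzero on [D] and
    zero elsewhere. *)
Lemma card_wsupp_setD n (E : {set 'I_n}) k :
  #|[set c : 'rV[F]_n | #|wsupp c :\: E| == k]|
    = ('C(n - #|E|, k) * (q ^ #|E| * q.-1 ^ k))%N.
Proof.
rewrite -sum1_card.
rewrite (partition_big (fun c => wsupp c :\: E)
   (fun D => (D \subset ~: E) && (#|D| == k))) /=; last first.
  by move=> c; rewrite inE setDE subsetIr.
have -> : (n - #|E|)%N = #|~: E| by rewrite [RHS]cardsCs setCK card_ord.
rewrite -cards_draws.
rewrite -sum_nat_cond_const; apply: eq_bigr => D /andP[sDE /eqP cD].
pose G i : pred F := if i \in E then predT else if i \in D then predC1 0 else pred1 0.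
transitivity #|family G|.
  pose h (f : {ffun 'I_n -> F}) : 'rV[F]_n := \row_i f i.
  have injh : injective h.
    by move=> f f' /rowP e; apply/ffunP => i; have := e i; rewrite !mxE.
  rewrite -(card_image injh) sum1_card; apply: eq_card => c.
  rewrite [LHS]unfold_in /= inE.
  apply/idP/imageP => [/andP[_ /eqP cED]|[f /familyP fG ->]].
    exists [ffun i => c 0 i]; last by apply/rowP => i; rewrite mxE ffunE.
    apply/familyP => i; rewrite ffunE /G.
    have : (i \in wsupp c :\: E) = (i \in D) by rewrite cED.
    rewrite !inE => <-.
    by case: (i \in E) => //=; case: eqVneq => // /eqP; rewrite ?inE.
  suff -> : wsupp (h f) :\: E = D by rewrite cD !eqxx.
  apply/setP => i; rewrite !inE mxE; have := fG i; rewrite /G.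
  have := subsetP sDE i; rewrite inE.
  case: (i \in E) => /=; first by case: (i \in D) => // /(_ isT).
  by case: (i \in D) => _; rewrite inE => /= ->.
rewrite card_family foldrE big_image /= (bigID (mem E)) /=; congr (_ * _)%N.
  rewrite -prod_nat_const; apply: eq_bigr => i iE; rewrite /G iE.
  by apply: eq_card.
rewrite -cD -prod_nat_const [RHS]big_mkcond [LHS]big_mkcond /=.
apply: eq_bigr => i _; rewrite /G; have := subsetP sDE i; rewrite inE.
case: (i \in E) => /=; first by case: (i \in D) => // /(_ isT).
by case: (i \in D) => _; rewrite ?cardC1 ?card1.
Qed.

(** Pigeonhole: two of the counted words share a syndrome, and their difference is supported on [E]
    and two sets of size [k]. *)
Lemma low_weight_codeword n (E : {set 'I_n}) k (x : L) :
  (q ^ \dim {:L} < 'C(n - #|E|, k) * (q ^ #|E| * q.-1 ^ k))%N ->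
  exists c : 'rV[F]_n, [/\ syndrome x c = 0, c != 0 & (hweight c <= k.*2 + #|E|)%N].
Proof.
rewrite -card_wsupp_setD; set A := [set _ | _] => ltA.
pose f c : 'rV[F]_(\dim {:L}) :=
  \row_i coord (vbasis {:L}) i (syndrome x (c : 'rV[F]_n)).
have : ~~ dinjectiveb f A.
  apply: contraL ltA => /dinjectiveP/leq_card_in.
  by rewrite card_mx mul1n -leqNgt.
case/dinjectivePn => u uA [v /andP[vu vA] /rowP fuv].
have {}fuv : syndrome x u = syndrome x v.
  rewrite (coord_vbasis (memvf (syndrome x u))) (coord_vbasis (memvf (syndrome x v))).
  by apply: eq_bigr => i _; have := fuv i; rewrite !mxE => ->.
exists (u - v); split; first by rewrite linearB /= fuv subrr.
  by rewrite subr_eq0 eq_sym.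
have : wsupp (u - v) \subset (wsupp u :\: E) :|: (wsupp v :\: E) :|: E.
  apply/subsetP => i; rewrite !inE !mxE; case: (i \in E); rewrite ?orbT //= orbF.
  by apply: contraR; rewrite negb_or !negbK => /andP[/eqP-> /eqP->]; rewrite subrr.
move/subset_leq_card/leq_trans; apply.
move: uA vA; rewrite !inE => /eqP cu /eqP cv.
apply: (leq_trans (leq_card_setU _ _)); rewrite leq_add2r.
by apply: (leq_trans (leq_card_setU _ _)); rewrite cu cv addnn.
Qed.

End Finite.

(** * Powers of [a] modulo [a^m + 1] *)

Section Order.
Variables (a m l : nat).
Hypotheses (a_gt1 : (1 < a)%N) (m_gt0 : (0 < m)%N).

Lemma order_mod_expn_succ : is_order_mod l a (a ^ m).+1 -> l = (2 * m)%N.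
Proof.
set N := (a ^ m).+1 => -[l_gt0 [al lmin]].
have a_gt0 : (0 < a)%N by apply: ltnW.
have N_gt1 : (1 < N)%N by rewrite ltnS expn_gt0 a_gt0.
have dvd2m : a ^ (2 * m) = 1 %[mod N].
  apply/eqP; rewrite eqn_mod_dvd ?expn_gt0 ?a_gt0 // mulnC expnM.
  by rewrite -[X in (_ - X)%N](exp1n 2) subn_sqr addn1 dvdn_mull.
have le_l : (l <= 2 * m)%N.
  rewrite leqNgt; apply/negP => lt_l; apply: (lmin (2 * m)%N) => //.
  by rewrite muln_gt0 m_gt0.
apply/eqP; rewrite eqn_leq le_l leqNgt /=; apply/negP => lt_l.
have [le_lm|lt_ml] := leqP l m.
  (* For [l <= m] both sides are below [N], so the congruence is an equality [a^l = 1]. *)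
  move: al; rewrite !modn_small // ?ltnS ?leq_exp2l // => /eqP.
  by rewrite -(expn0 a) eqn_exp2l // -leqn0 leqNgt l_gt0.
(* [a ^ l = a ^ (l - m) * a ^ m] is congruent to [- a ^ (l - m)] *)
have : a ^ (l - m) + a ^ l = 0 %[mod N].
  by rewrite -{2}(subnK (ltnW lt_ml)) expnD -mulnS modnMl mod0n.
rewrite -modnDmr al modnDmr mod0n modn_small.
  by rewrite addn1.
rewrite addn1 ltnS ltn_exp2l //; lia.
Qed.

(** Cancelling the smaller power would give an exponent below [l] with power 1. Used to show that
    the conjugates of [beta] are distinct. *)
Lemma order_mod_inj N : coprime N a -> is_order_mod l a N ->
  forall i j, (i < l)%N -> (j < l)%N -> a ^ i = a ^ j %[mod N] -> i = j.
Proof.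
move=> cop [_ [_ lmin]].
have aux i j : (i < j < l)%N -> a ^ i = a ^ j %[mod N] -> False.
  move=> /andP[ij jl] /esym/eqP; have ji := ltnW ij.
  have le_exp : (a ^ i <= a ^ j)%N by rewrite leq_exp2l.
  rewrite eqn_mod_dvd // -(subnKC ji) expnD -[X in (_ - X)%N]muln1 -mulnBr.
  rewrite Gauss_dvdr ?coprimeXr // -eqn_mod_dvd ?expn_gt0 ?(ltnW a_gt1) //.
  by move=> /eqP; apply: lmin; rewrite subn_gt0 ij (leq_ltn_trans _ jl) ?leq_subr.
move=> i j il jl e; case: (ltngtP i j) => // lt.
  by case: (@aux i j); rewrite ?lt.
by case: (@aux j i); rewrite ?lt.
Qed.

End Order.

(** * Three-term relations between roots of unity *)

Section Trinomial.

(** Isolating the [c] terms and multiplying the two relations eliminates [z]. *)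
Lemma three_term_ratio (K : fieldType) (a b c x y z : K) :
  a != 0 -> b != 0 -> x != 0 -> y != 0 -> z != 0 ->
  a * x + b * y + c * z = 0 -> a * x^-1 + b * y^-1 + c * z^-1 = 0 ->
  x / y + y / x = (c ^+ 2 - a ^+ 2 - b ^+ 2) / (a * b).
Proof.
move=> a0 b0 x0 y0 z0 e1 e2.
have -> : c ^+ 2 = (a * x + b * y) * (a * x^-1 + b * y^-1).
  have -> : c ^+ 2 = (c * z) * (c * z^-1) by field.
  move/eqP: e1; rewrite addr_eq0 => /eqP ->.
  by move/eqP: e2; rewrite addr_eq0 => /eqP ->; rewrite mulrNN.
by field; rewrite x0 y0 a0 b0.
Qed.

Lemma addrV_inj (K : fieldType) (u v : K) : u != 0 -> v != 0 ->
  u + u^-1 = v + v^-1 -> u = v \/ u = v^-1.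
Proof.
move=> u0 v0 e; have : (u - v) * (u * v - 1) = 0.
  have -> : (u - v) * (u * v - 1) = u * v * ((u + u^-1) - (v + v^-1)).
    by field; rewrite u0 v0.
  by rewrite e subrr mulr0.
move/eqP; rewrite mulf_eq0 !subr_eq0 => /orP[/eqP|/eqP uv1]; [by left|right].
by rewrite -[LHS](mulfK v0) uv1 mul1r.
Qed.

Variables (F : finFieldType) (L : fieldExtType F) (m : nat).
Local Notation q := #|F|.

Lemma three_term_relation_sqr (a b c : F) (x y z : L) : ~~ odd m ->
  a != 0 -> b != 0 -> x ^+ (q ^ m).+1 = 1 -> y ^+ (q ^ m).+1 = 1 ->
  z ^+ (q ^ m).+1 = 1 -> a *: x + b *: y + c *: z = 0 -> x ^+ 2 = y ^+ 2.
Proof.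
move=> even_m a0 b0 xN yN zN e.
have unit_neq0 (w : L) : w ^+ (q ^ m).+1 = 1 -> w != 0.
  by move=> wN; apply/eqP => w0; move/eqP: wN; rewrite w0 expr0n eq_sym oner_eq0.
have expr_conj (w : L) : w ^+ (q ^ m).+1 = 1 -> w ^+ (q ^ m) = w^-1.
  move=> wN; rewrite -[LHS](mulfK (unit_neq0 w wN)) -exprSr wN mul1r //.
have [x0 [y0 z0]] := conj (unit_neq0 x xN) (conj (unit_neq0 y yN) (unit_neq0 z zN)).
have e' : a *: x^-1 + b *: y^-1 + c *: z^-1 = 0.
  by rewrite -!expr_conj // -!exprq_scale -!exprqD e expr0q.
pose u := x / y.
have u0 : u != 0 by rewrite mulf_neq0 ?invr_eq0.
pose t := (c ^+ 2 - a ^+ 2 - b ^+ 2) / (a * b).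
have ut : u + u^-1 = in_alg L t.
  rewrite fmorph_div (rmorphM (in_alg L) a b) !rmorphB !rmorphXn invf_div.
  by apply: (three_term_ratio (z := z)); rewrite ?fmorph_eq0 /= ?mulr_algl.
have uq : u ^+ q + (u ^+ q)^-1 = u + u^-1.
  by rewrite -exprVn -[q]expn1 -exprqD ut expn1 -rmorphXn /= expf_card.
(* [u^q] is [u] or its inverse; either way a second q-th power returns [u]. *)
have uqq : u ^+ (q ^ 2) = u.
  have [uqu|uqu] := addrV_inj (expf_neq0 q u0) u0 uq; first by rewrite exprM !uqu.
  by rewrite exprM uqu exprVn uqu invrK.
have uqm k : u ^+ (q ^ k.*2) = u.
  elim: k => // k IH; by rewrite doubleS -addn2 expnD exprM IH uqq.
have uN : u ^+ (q ^ m).+1 = 1 by rewrite exprMn exprVn xN yN invr1 mulr1.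
(* The power [q^m] inverts [u], but for even [m] it also fixes [u]. *)
have := expr_conj u uN; rewrite -(odd_double_half m) (negPf even_m) add0n uqm => uV.
have : u ^+ 2 = 1 by rewrite expr2 {2}uV mulfV.
rewrite exprMn exprVn => /(congr1 ( *%R^~ (y ^+ 2))).
by rewrite mulfVK ?mul1r // expf_neq0.
Qed.

End Trinomial.

(** * Lower and upper bounds on the minimum distance *)

Section MinimumDistance.
Variables (F : finFieldType) (L : fieldExtType F) (m n : nat) (beta : L).
Local Notation q := #|F|.
Hypothesis n_def : (2 * n = (q ^ m).+1)%N.
Hypothesis betaP : ((q ^ m).+1).-primitive_root beta.

Lemma length_gt0 : (0 < n)%N. Proof. by case: (n) n_def. Qed.

Lemma expr_length : beta ^+ n = -1.
Proof.
have n_gt0 := length_gt0.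
have /eqP : (beta ^+ n) ^+ 2 = 1 by rewrite -exprM mulnC n_def (prim_expr_order betaP).
rewrite sqrf_eq1 => /orP[|/eqP//].
by rewrite -(prim_order_dvd betaP) -n_def => /dvdn_leq; lia.
Qed.

Lemma sqr_root_prim : n.-primitive_root (beta ^+ 2).
Proof.
have dvd_n : (n %| (q ^ m).+1)%N by rewrite -n_def dvdn_mull.
by have := dvdn_prim_root betaP dvd_n; rewrite -n_def mulnK ?length_gt0.
Qed.

Lemma root_neq0 : beta != 0.
Proof. by rewrite (prim_root_eq0 betaP). Qed.

Lemma expr_order_add i j : beta ^+ (i + j * (q ^ m).+1) = beta ^+ i.
Proof. by rewrite exprD mulnC exprM (prim_expr_order betaP) expr1n mulr1. Qed.

Lemma syndrome_conj (c : 'rV[F]_n) k :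
  syndrome beta c = 0 -> syndrome (beta ^+ (q ^ k)) c = 0.
Proof. by move=> c0; rewrite syndromeXq c0 expr0q. Qed.

(** The zeros [beta^-1 = beta^(q^m)] and [beta] are consecutive in steps of [beta^2], which has
    order [n]. *)
Lemma hweight_gt2 (c : 'rV[F]_n) : syndrome beta c = 0 -> c != 0 -> (2 < hweight c)%N.
Proof.
move=> c_code c0; apply: (@bch_bound F L n 2 (beta ^+ (q ^ m)) (beta ^+ 2)) => //.
- exact: sqr_root_prim.
- by rewrite expf_neq0 ?root_neq0.
case=> [|[|//]] _; first by rewrite expr0 mulr1 syndrome_conj.
rewrite expr1 -exprD addn2 -addn1 -(mul1n _.+1) addnC expr_order_add.
by rewrite -(expn0 q) syndrome_conj.
Qed.

Lemma hweight_gt4 (c : 'rV[F]_n) :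
  q = 3%N -> syndrome beta c = 0 -> c != 0 -> (4 < hweight c)%N.
Proof.
move=> q3 c_code c0; apply: (@bch_bound F L n 4 (beta ^+ (q ^ m.+1)) (beta ^+ 2)) => //.
- exact: sqr_root_prim.
- by rewrite expf_neq0 ?root_neq0.
(* the four exponents are congruent to -3, -1, 1 and 3 modulo 2n *)
have red i j k : (q ^ m.+1 + 2 * k = q ^ i + j * (q ^ m).+1)%N ->
    syndrome (beta ^+ (q ^ m.+1) * (beta ^+ 2) ^+ k) c = 0.
  by move=> e; rewrite -exprM -exprD e expr_order_add syndrome_conj.
case=> [|[|[|[|//]]]] _.
- by apply: (red m.+1 0); lia.
- by apply: (red m 2); rewrite expnS {1}q3; lia.
- by apply: (red 0 3); rewrite expnS {1}q3; lia.
- by apply: (red 1 3); rewrite expnS {1 3}q3; lia.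
Qed.

(** A word of weight 3 gives a three-term relation, so [beta^(2i) = beta^(2j)] for two support
    positions; both are below [n], the order of [beta^2], so they coincide. *)
Lemma hweight_neq3 (c : 'rV[F]_n) : ~~ odd m -> syndrome beta c = 0 -> hweight c != 3%N.
Proof.
move=> even_m c_code; apply/negP => /eqP c3.
have [i ci] : exists i, i \in wsupp c by apply/card_gt0P; rewrite -/(hweight c) c3.
have /cards2P[j [k [jk wc]]] : #|wsupp c :\ i| == 2.
  by have : #|wsupp c| = 3 := c3; rewrite (cardsD1 i) ci add1n => /eqP.
have /setD1P[ji cj] : j \in wsupp c :\ i by rewrite wc !inE eqxx.
have ck : k \in wsupp c :\ i by rewrite wc !inE eqxx orbT.
have rel : c 0 i *: beta ^+ i + c 0 j *: beta ^+ j + c 0 k *: beta ^+ k = 0.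
  move: c_code; rewrite /syndrome (bigID (mem (wsupp c))) /= addrC big1.
    by rewrite add0r (big_setD1 i) //= wc big_setU1 ?inE //= big_set1 addrA.
  by move=> s; rewrite inE negbK => /eqP ->; rewrite scale0r.
have root1 s : (beta ^+ s) ^+ (q ^ m).+1 = 1.
  by rewrite exprAC (prim_expr_order betaP) expr1n.
rewrite !inE in ci cj; move/negP: ji; apply.
have /eqP := three_term_relation_sqr even_m ci cj (root1 i) (root1 j) (root1 k) rel.
rewrite !(exprAC _ _ 2) (eq_prim_root_expr sqr_root_prim) !modn_small //.
by rewrite eq_sym.
Qed.

Lemma odd_card_ge5 : odd q -> q != 3%N -> (5 <= q)%N.
Proof. by move: (finNzRing_gt1 F); case: q => [|[|[|[|[]]]]]. Qed.

Lemma codeword_weight_le3 : odd q -> (q != 3)%N -> odd m ->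
  exists c : 'rV[F]_n, [/\ syndrome beta c = 0, c != 0 & (hweight c <= 3)%N].
Proof.
move=> q_odd q_neq3 m_odd; have q_ge5 := odd_card_ge5 q_odd q_neq3.
have dvd_q1 : (q.+1 %| (q ^ m).+1)%N.
  rewrite -{1}[q]expn1 -(odd_double_half m) m_odd.
  elim: m./2 => [|k IH]; first by rewrite addn0.
  have -> : (q ^ (true + k.+1.*2)).+1 =
      (q ^ 2 * (q ^ (true + k.*2)).+1 - q.-1 * q.+1)%N.
    by rewrite doubleS !addnS !expnS; nia.
  by rewrite dvdn_sub ?dvdn_mull // -[q in (q.+1 %| _)%N]expn1.
set s := ((q ^ m).+1 %/ q.+1)%N.
have sN : (s * q.+1 = (q ^ m).+1)%N by rewrite divnK.
have s_gt0 : (0 < s)%N by case: (s) sN.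
(* [s (q + 1) = 2n] gives [2s = 4n / (q + 1) < n], since [q >= 5]. *)
have lt_2s : (2 * s < n)%N by nia.
have gP : q.+1.-primitive_root (beta ^+ s) by apply: dvdn_prim_root.
set g := beta ^+ s in gP.
have g0 : g != 0 by rewrite (prim_root_eq0 gP).
have gq : g ^+ q = g^-1.
  by rewrite -[LHS](mulfK g0) -exprSr (prim_expr_order gP) mul1r.
(* The q-th power swaps [g] and its inverse, so it fixes their sum. *)
have [t gt] : exists t : F, g + g^-1 = t%:A.
  by apply: exprq_fixed; rewrite -{1}[q]expn1 exprqD expn1 exprVn gq invrK addrC.
have lt_s : (s < n)%N by lia.
pose e i : 'rV[F]_n := delta_mx 0 i.
pose c := e (Ordinal length_gt0) - t *: e (Ordinal lt_s) + e (Ordinal lt_2s).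
have cE i : c 0 i =
    (i == 0 :> nat)%:R - t * (i == s :> nat)%:R + (i == 2 * s :> nat)%N%:R.
  by rewrite !mxE /= -!val_eqE.
exists c; split.
- rewrite linearD linearB linearZ /= !syndrome_delta /= expr0 mulnC exprM -/g.
  rewrite -mulr_algl -gt mulrDl mulVf // -expr2.
  by rewrite addrAC [_ + 1]addrC subrr.
- apply/eqP => /rowP /(_ (Ordinal length_gt0)); rewrite cE mxE /=.
  have -> : (0 == s)%N = false by lia.
  have -> : (0 == 2 * s)%N = false by lia.
  by rewrite mulr0 subr0 addr0 => /eqP; rewrite oner_eq0.
have /subset_leq_card/leq_trans : wsupp c \subset
    [set Ordinal length_gt0; Ordinal lt_s] :|: [set Ordinal lt_2s].
  apply/subsetP => i; rewrite !inE cE -!val_eqE /=; apply: contraR.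
  rewrite !negb_or => /andP[/andP[/negPf-> /negPf->] /negPf->].
  by rewrite mulr0 subr0 addr0.
apply; apply: (leq_trans (leq_card_setU _ _)).
by rewrite cards1 cards2 addn1 ltnS; case: (_ != _).
Qed.

Hypotheses (m_gt1 : (1 < m)%N) (dimL : \dim {:L} = (2 * m)%N).

(** The number of possible syndromes, in terms of [n] for comparison with the word counts. *)
Lemma card_ambient : (q ^ \dim {:L} = (2 * n).-1 ^ 2)%N.
Proof. by rewrite dimL n_def mulnC expnM. Qed.

Lemma codeword_weight_le4 : odd q -> (q != 3)%N ->
  exists c : 'rV[F]_n, [/\ syndrome beta c = 0, c != 0 & (hweight c <= 4)%N].
Proof.
move=> q_odd q_neq3; have q_gt1 := finNzRing_gt1 F.
have q_ge5 := odd_card_ge5 q_odd q_neq3.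
have n_ge3 : (3 <= n)%N.
  have : (q ^ 2 <= q ^ m)%N by rewrite leq_exp2l.
  by nia.
(* There are at least [16 n (n - 1) / 2] words of weight 2, more than [(2n - 1)^2]. *)
have := @low_weight_codeword F L n set0 2 beta; rewrite cards0 subn0 addn0; apply.
rewrite card_ambient expn0 mul1n; have := bin_ffact n 2.
rewrite ffactnS ffactn1 !factS fact0 => B2.
have : (4 ^ 2 <= q.-1 ^ 2)%N by rewrite leq_exp2r //; lia.
move: (q.-1 ^ 2)%N => X X_ge16; nia.
Qed.

Lemma codeword_weight_le5 : q = 3%N ->
  exists c : 'rV[F]_n, [/\ syndrome beta c = 0, c != 0 & (hweight c <= 5)%N].
Proof.
move=> q3; have [m2|m_neq2] := eqVneq m 2.
  have n5 : n = 5 by move: n_def; rewrite q3 m2; lia.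
  (* All [3^5 = 243] words are counted against 81 syndromes. *)
  have := @low_weight_codeword F L n setT 0 beta.
  rewrite cardsT card_ord card_ambient bin0 q3 n5 => -[] // c [? ? ?].
  by exists c; split; rewrite // -n5.
have n_ge14 : (14 <= n)%N.
  have : (3 ^ 3 <= q ^ m)%N by rewrite q3 leq_exp2l //; lia.
  by lia.
(* With one free coordinate the count is [6 (n - 1) (n - 2)], which exceeds [(2n - 1)^2] once
   [n >= 7]. *)
have := @low_weight_codeword F L n [set Ordinal length_gt0] 2 beta.
rewrite cards1; apply; rewrite card_ambient q3.
have := bin_ffact (n - 1) 2.
rewrite ffactnS ffactn1 !factS fact0 expn1 => B2.
have -> : (3.-1 ^ 2 = 4)%N by [].
nia.
Qed.

End MinimumDistance.

(** * The parameters of the code *)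

Theorem theorem34 (F : finFieldType) (m n l : nat) (L : fieldExtType F)
    (alpha : L) (g : {poly F}) :
  odd #|F| -> (2 <= m)%N ->
  n = ((#|F| ^ m).+1 %/ 2)%N ->
  is_order_mod l #|F| (2 * n) ->
  \dim {:L} = l ->
  (#|F| ^ l).-1.-primitive_root alpha ->
  is_min_poly g (alpha ^+ ((#|F| ^ l).-1 %/ (2 * n))) ->
  negacyclic_params n g (n - 2 * m)
    (if #|F| == 3%N then 5%N else if odd m then 3%N else 4%N).
Proof.
move=> q_odd m_gt1 n_def l_order dimL alphaP; set beta := alpha ^+ _ => g_min.
have q_gt1 := finNzRing_gt1 F.
have n2 : (2 * n = (#|F| ^ m).+1)%N.
  by rewrite n_def mulnC divnK // dvdn2 /= oddX q_odd orbT.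
rewrite n2 in l_order.
have l_def := order_mod_expn_succ q_gt1 (ltnW m_gt1) l_order.
have betaP : ((#|F| ^ m).+1).-primitive_root beta.
  rewrite /beta n2; apply: dvdn_prim_root => //.
  rewrite -subn1 -(eqn_mod_dvd _ (_ : 0 < _)%N) ?expn_gt0 ?(ltnW q_gt1) //.
  by case: l_order => _ [/eqP].
have codeP c := in_negacyclic_codeP c (length_gt0 n2) g_min (expr_length n2 betaP).
(* The dimension count needs [dim L <= n]; it follows from [4m <= 3^m <= q^m < 2n]. *)
have le_2m_n : (2 * m <= n)%N.
  have : (4 * m <= 3 ^ m)%N.
    by case: (m) m_gt1 => [|[|k]] // _; elim: k => // k; rewrite !expnS; lia.
  have : (3 ^ m <= #|F| ^ m)%N.
    rewrite leq_exp2r ?(ltnW m_gt1) //.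
    by move: q_odd q_gt1; case: #|F| => [|[|[]]].
  by lia.
split; last split.
- exists (lker (linfun (@syndrome F L n beta))); split.
    by move=> c; rewrite codeP memv_ker lfunE /=; split=> /eqP.
  rewrite dim_syndrome_ker dimL l_def // => i j; rewrite !inE -l_def => il jl /eqP.
  rewrite (eq_prim_root_expr betaP) => /eqP.
  apply: (order_mod_inj q_gt1 _ l_order) => //.
  (* [q] is coprime to [q^m + 1] because [q^m] and its successor are coprime. *)
  rewrite coprime_sym -(@coprime_pexpl m) ?coprimenS //; lia.
- have [q3|q_neq3] := eqVneq #|F| 3.
    have [c [cc c0 cw]] := codeword_weight_le5 n2 betaP m_gt1 (etrans dimL l_def) q3.
    exists c; split; [exact/codeP|split=> //].
    by apply/eqP; rewrite eqn_leq cw (hweight_gt4 n2 betaP q3).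
  case: ifP => m_odd.
    have [c [cc c0 cw]] := codeword_weight_le3 n2 betaP q_odd q_neq3 m_odd.
    exists c; split; [exact/codeP|split=> //].
    by apply/eqP; rewrite eqn_leq cw (hweight_gt2 n2 betaP).
  have [c [cc c0 cw]] :=
    codeword_weight_le4 n2 betaP m_gt1 (etrans dimL l_def) q_odd q_neq3.
  exists c; split; [exact/codeP|split=> //].
  apply/eqP; rewrite eqn_leq cw ltn_neqAle eq_sym.
  by rewrite (hweight_neq3 n2 betaP) ?m_odd // (hweight_gt2 n2 betaP).
move=> c /codeP cc c0.
have [q3|q_neq3] := eqVneq #|F| 3; first exact: (hweight_gt4 n2 betaP q3).
case: ifP => m_odd; first exact: (hweight_gt2 n2 betaP).
rewrite ltn_neqAle eq_sym (hweight_neq3 n2 betaP) ?m_odd //.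
exact: (hweight_gt2 n2 betaP).
Qed.
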